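(* Let $F$ be a known, strictly monotone distribution function on $\mathbb{R}$. Assume that for covariate values $x\in\mathbb{R}^p$, $$Y\mid x\sim N(\gamma_0+x^T\gamma_1,\sigma^2),\qquad P(R=1\mid x,y)=F(\alpha_0+x^T\alpha_1+\beta y),$$ with unknown parameters $\gamma_0,\alpha_0,\beta\in\mathbb{R}$, $\gamma_1,\alpha_1\in\mathbb{R}^p$, $\sigma^2>0$. Assume that it is not the case that for every $\delta>0$ the limit $\lim_{z\to-\infty}F(z)/e^{\delta z}$ equals $0$ or $+\infty$; that is, assume $\lim_{z\to-\infty}F(z)/e^{\delta z}=c$ for some $\delta>0$ and some $c\in(0,+\infty)$. Define $$\tau_1=2\delta(\alpha_0+\beta\gamma_0)+\delta^2\sigma^2\beta^2+2\log(c),\qquad \tau_2=\alpha_1+\beta\gamma_1.$$ Then: (a) for a general such distribution function $F$, the condition ''$\tau_1\neq0$ or $\tau_2\neq0$'' is sufficient for identifiability of $(\gamma_0,\gamma_1,\sigma^2,\alpha_0,\alpha_1)$ and $\beta$; (b) if $F$ is the Logistic distribution function $F(z)=e^z/(1+e^z)$, the condition ''$\tau_1\neq0$ or $\tau_2\neq0$'' is necessary and sufficient for identifiability of $(\gamma_0,\gamma_1,\sigma^2,\alpha_0,\alpha_1)$ and $\beta$.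
   Context: $X$ denotes completely observed covariates (with values $x$), $Y$ is an outcome variable and $R\in\{0,1\}$ is its missingness indicator ($R=1$ if $Y$ is observed, $R=0$ otherwise). The observed distribution is $P(y,R=1\mid x)$, which here is the function $(x,y)\mapsto\frac{1}{\sigma}\phi\left(\frac{y-\gamma_0-x^T\gamma_1}{\sigma}\right)F(\alpha_0+x^T\alpha_1+\beta y)$, where $\phi$ is the standard normal density. It is assumed that the functions $x\mapsto\gamma_0+x^T\gamma_1$ and $x\mapsto\alpha_0+x^T\alpha_1$ on the set of covariate values are in one-to-one correspondence with their coefficients $(\gamma_0,\gamma_1)$ and $(\alpha_0,\alpha_1)$. The parameters are identifiable if they are uniquely determined by the observed distribution, i.e. every parameter vector yielding the same observed distribution coincides with the given one; $\tau_1,\tau_2$ are evaluated at the parameter vector under consideration. For the Logistic distribution function, $\delta=c=1$.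
   Formalization: In (b), necessity of ''τ1≠0 or τ2≠0'' is stated only for β≠0: at β=0, α0=0, α1=0 (response probability 1/2) both τ1 and τ2 vanish, yet the parameters are identifiable, so the claim fails there; sufficiency is kept for all β. *)

(* Defs.v *)
From HB Require Import structures.
From mathcomp Require Import all_boot all_order all_algebra.
From mathcomp Require Import all_classical all_reals all_analysis.

Set Implicit Arguments.
Unset Strict Implicit.
Unset Printing Implicit Defensive.

Import Order.TTheory GRing.Theory Num.Theory.
Import numFieldNormedType.Exports.

Local Open Scope classical_set_scope.
Local Open Scope ring_scope.

Record param (R : realType) (p : nat) := Param {
  gamma0 : R;
  gamma1 : 'cV[R]_p;
  sigma2 : R;
  alpha0 : R;
  alpha1 : 'cV[R]_p;
  beta   : R }.

Definition affine (R : realType) (p : nat) (a : R) (b x : 'cV[R]_p) : R :=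
  a + (x^T *m b) 0 0.

(* Both x |-> gamma0 + x^T gamma1 and x |-> alpha0 + x^T alpha1 range over the
   affine functions on the covariate set X, so one injectivity condition
   covers the two of them.  It entails in particular that X is nonempty. *)
Definition one_to_one_coefficients (R : realType) (p : nat)
    (X : set 'cV[R]_p) : Prop :=
  forall (a a' : R) (b b' : 'cV[R]_p),
    (forall x, X x -> affine a b x = affine a' b' x) -> a = a' /\ b = b'.

(* density of Y at y given X = x; normal_pdf 0 1 is the standard normal
   density, and normal_pdf takes the standard deviation, not the variance *)
Definition outcome_pdf (R : realType) (p : nat) (t : param R p)
    (x : 'cV[R]_p) (y : R) : R :=
  let sigma := Num.sqrt (sigma2 t) in
  sigma^-1 * normal_pdf 0 1 ((y - affine (gamma0 t) (gamma1 t) x) / sigma).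

(* P(R = 1 | x, y) *)
Definition response_prob (R : realType) (p : nat) (F : R -> R) (t : param R p)
    (x : 'cV[R]_p) (y : R) : R :=
  F (affine (alpha0 t) (alpha1 t) x + beta t * y).

(* P(y, R = 1 | x) *)
Definition observed (R : realType) (p : nat) (F : R -> R) (t : param R p)
    (x : 'cV[R]_p) (y : R) : R :=
  outcome_pdf t x y * response_prob F t x y.

Definition identifiable (R : realType) (p : nat) (F : R -> R)
    (X : set 'cV[R]_p) (t : param R p) : Prop :=
  forall t' : param R p, 0 < sigma2 t' ->
    (forall x, X x -> forall y : R, observed F t' x y = observed F t x y) ->
    t' = t.

Definition exp_left_tail (R : realType) (F : R -> R) (delta c : R) : Prop :=
  [/\ 0 < delta, 0 < c & F z / expR (delta * z) @[z --> -oo] --> c].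

Definition tau1 (R : realType) (p : nat) (delta c : R) (t : param R p) : R :=
  2 * delta * (alpha0 t + beta t * gamma0 t)
  + delta ^+ 2 * sigma2 t * beta t ^+ 2 + 2 * ln c.

Definition tau2 (R : realType) (p : nat) (t : param R p) : 'cV[R]_p :=
  alpha1 t + beta t *: gamma1 t.

(* Pitfall: for the logistic F (delta = c = 1), if tau1 = tau2 = 0 then
   (gamma0 + beta sigma2, gamma1, sigma2, - alpha0, - alpha1, - beta) has the
   same observed distribution as t.  It differs from t only when beta != 0: if
   beta = 0, then tau1 = tau2 = 0 means alpha0 = 0 and alpha1 = 0, both vectors
   are equal, and t (constant response probability 1/2) is identifiable.  So
   "tau1 != 0 or tau2 != 0" is necessary for identifiability only at parameter
   vectors with beta != 0. *)
Definition logistic (R : realType) (z : R) : R := expR z / (1 + expR z).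

Section logistic_distribution_function.
Variable R : realType.
Implicit Types x y z : R.

Let expR1_gt0 z : 0 < 1 + expR z.
Proof. by rewrite addr_gt0// expR_gt0. Qed.

Let expRNy : expR z @[z --> (-oo : set_system R)] --> (0 : R).
Proof. by apply/cvgNy_compNP; exact: cvgr_expR. Qed.

Let expR1VNy : (1 + expR z)^-1 @[z --> (-oo : set_system R)] --> (1 : R).
Proof.
rewrite -[X in _ --> X]invr1; apply: cvgV; first exact: oner_neq0.
by rewrite -[X in _ --> X]addr0; apply: cvgD; [exact: cvg_cst|exact: expRNy].
Qed.

Lemma logistic_expRN z : logistic z = (1 + expR (- z))^-1.
Proof.
have e0 : expR z != 0 by rewrite gt_eqF// expR_gt0.
have e1 : 1 + (expR z)^-1 != 0.
  by rewrite gt_eqF// addr_gt0// invr_gt0 expR_gt0.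
have e2 : 1 + expR z != 0 by rewrite gt_eqF// expR1_gt0.
rewrite /logistic expRN; apply: (mulIf e2); rewrite mulfVK//.
apply: (mulfI e1); rewrite mulrA mulfV// mul1r.
by rewrite mulrDl mul1r mulVf// addrC.
Qed.

Lemma logistic_increasing : {homo @logistic R : x y / x < y}.
Proof.
move=> x y xy; rewrite !logistic_expRN ltf_pV2 ?posrE ?expR1_gt0//.
by rewrite ltrD2l ltr_expR ltrN2.
Qed.

Let logistic_nd : nondecreasing (@logistic R).
Proof. by move=> x y; rewrite le_eqVlt => /predU1P[->//|/logistic_increasing/ltW]. Qed.

Let logistic_rc : right_continuous (@logistic R).
Proof.
apply/right_continuousW => x; apply: cvgM; first exact: continuous_expR.
apply: cvgV; first by rewrite gt_eqF// expR1_gt0.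
by apply: cvgD; [exact: cvg_cst|exact: continuous_expR].
Qed.

Let logisticNy : @logistic R @ -oo --> (0 : R).
Proof. by rewrite -[X in _ --> X](mul0r (1 : R)); exact: cvgM expRNy expR1VNy. Qed.

Let logisticy : @logistic R @ +oo --> (1 : R).
Proof.
apply/cvgy_compNP; have -> : @logistic R \o -%R = fun z => (1 + expR z)^-1.
  by apply/funext => z /=; rewrite logistic_expRN opprK.
exact: expR1VNy.
Qed.

HB.instance Definition _ :=
  isCumulative.Build R _ R (@logistic R) logistic_nd logistic_rc.
HB.instance Definition _ :=
  isCumulativeBounded.Build R 0 1 (@logistic R) logisticNy logisticy.

Lemma logistic_exp_left_tail : exp_left_tail (@logistic R) 1 1.
Proof.
split=> //; have -> : (fun z => logistic z / expR (1 * z)) =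
    fun z => (1 + expR z)^-1.
  by apply/funext => z; rewrite /logistic mul1r mulrAC mulfV ?mul1r// gt_eqF// expR_gt0.
exact: expR1VNy.
Qed.

End logistic_distribution_function.

(* Main.v *)
Require Import Defs.
From mathcomp Require Import all_boot all_order all_algebra.
From mathcomp Require Import all_classical all_reals all_analysis.
From mathcomp Require Import ring lra.

(* Taking logarithms, the observed distribution is a quadratic polynomial in y
   plus ln F(a + beta y), where a = alpha0 + x^T alpha1.  The latter is
   asymptotic, up to o(1), to an affine function of y at each of -oo and +oo:
   to delta (a + beta y) + ln c at the end where a + beta y tends to -oo, and
   to 0 at the other end (if beta != 0).  A polynomial that is o(1) vanishes,
   so two parameter vectors with the same observed distribution have the same
   coefficients at both ends.  This forces sigma2' = sigma2 and
   |beta'| = |beta|; if beta' = beta, then everything else agrees, and if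
   beta' = - beta != 0, then tau1 + 2 delta x^T tau2 = 0 for all x. *)

Set Implicit Arguments.
Unset Strict Implicit.
Unset Printing Implicit Defensive.

Import Order.TTheory GRing.Theory Num.Theory.
Import numFieldNormedType.Exports.

Local Open Scope classical_set_scope.
Local Open Scope ring_scope.

(** * Quadratic polynomials and Gaussian exponents at infinity *)

Section asymptotics.
Variable R : realType.
Implicit Types (a b c d m n y : R) (f g : R -> R).

(** The second difference is the constant [2 * a] and tends to 0 along with the polynomial; the
    first difference then yields [b], and only the constant [c] remains. *)
Lemma quadratic_cvg0 a b c :
  a * y ^+ 2 + b * y + c @[y --> +oo] --> (0 : R) -> [/\ a = 0, b = 0 & c = 0].
Proof.
move=> f0; pose f y := a * y ^+ 2 + b * y + c.
have f1 : f (y + 1) @[y --> +oo] --> (0 : R) by rewrite (cvg_shiftr 1 f).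
have f2 : f (y + 2) @[y --> +oo] --> (0 : R) by rewrite (cvg_shiftr 2 f).
have const0 d : d @[y --> (+oo : set_system R)] --> (0 : R) -> d = 0.
  by move=> d0; apply: (cvg_unique _ (@cvg_cst _ d _ +oo _) d0).
have a0 : a = 0.
  suff : 2 * a = 0 by lra.
  apply: const0; rewrite [X in _ --> X](_ : 0 = 0 - (0 + 0) + 0); last by ring.
  rewrite (_ : (fun=> _) = fun y => f (y + 2) - (f (y + 1) + f (y + 1)) + f y).
    exact: cvgD (cvgB f2 (cvgD f1 f1)) f0.
  by apply/funext => y; rewrite /f; ring.
have b0 : b = 0.
  apply: const0; rewrite [X in _ --> X](_ : 0 = 0 - 0); last by ring.
  rewrite (_ : (fun=> b) = fun y => f (y + 1) - f y); first exact: cvgB f1 f0.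
  by apply/funext => y; rewrite /f a0; ring.
split=> //; apply: const0; move: f0; rewrite a0 b0.
by under eq_fun do rewrite !mul0r !add0r.
Qed.

Lemma cvgy_affine a b : 0 < b -> a + b * y @[y --> +oo] --> (+oo : set_system R).
Proof.
move=> b0; apply/cvgryPge => A; near=> y.
by rewrite -lerBlDl mulrC -ler_pdivrMr.
Unshelve. all: by end_near. Qed.

Lemma cvgNy_affine a b : b < 0 -> a + b * y @[y --> +oo] --> (-oo : set_system R).
Proof.
move=> b0; apply/cvgNry; rewrite (_ : - _ = fun y => - a + - b * y).
  by apply: cvgy_affine; rewrite oppr_gt0.
by apply/funext => y /=; rewrite !fctE; ring.
Qed.

Lemma cvg_lnF f (l : R) (F : set_system R) {FF : Filter F} : 0 < l ->
  f y @[y --> F] --> l -> ln (f y) @[y --> F] --> ln l.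
Proof. by move=> l0 fl; exact: continuous_cvg (continuous_ln l0) fl. Qed.

(** Subtracting the two remainders eliminates [g] and [g'] and leaves a quadratic in [y] that tends
    to 0; its three coefficients give the three conclusions. *)
Lemma gaussian_tail_eq k k' s s' mu mu' m m' n n' g g' : 0 < s -> 0 < s' ->
  g y - (m * y + n) @[y --> +oo] --> (0 : R) ->
  g' y - (m' * y + n') @[y --> +oo] --> (0 : R) ->
  (forall y, k - (y - mu) ^+ 2 / (2 * s) + g y
           = k' - (y - mu') ^+ 2 / (2 * s') + g' y) ->
  [/\ s' = s, m - m' = (mu' - mu) / s &
      k' - k + (mu ^+ 2 - mu' ^+ 2) / (2 * s) = n - n'].
Proof.
move=> s0 s'0 cg cg' gg'.
have [A B C] : [/\ (2 * s)^-1 - (2 * s')^-1 = 0,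
    mu' / s' - mu / s + (m' - m) = 0 &
    k' - k + mu ^+ 2 / (2 * s) - mu' ^+ 2 / (2 * s') + (n' - n) = 0].
  apply: quadratic_cvg0.
  rewrite [X in _ --> X](_ : 0 = 0 - 0); last by ring.
  rewrite (_ : (fun y => _) = fun y => g y - (m * y + n) - (g' y - (m' * y + n'))).
    exact: cvgB cg cg'.
  apply/funext => y.
  have -> : g y = k' - (y - mu') ^+ 2 / (2 * s') + g' y - k
      + (y - mu) ^+ 2 / (2 * s) by move: (gg' y); lra.
  by field; rewrite !gt_eqF.
have ss' : s' = s by move/subr0_eq/invr_inj: A => A; lra.
subst s'; split=> //; first by move: B; rewrite mulrBl; lra.
by move: C; rewrite mulrBl; lra.
Qed.

End asymptotics.

(** * Tails of the log-response, and comparison at a fixed covariate value *)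

Section tails.
Variables (R : realType) (F : cumulativeBounded (0 : R) (1 : R)).
Hypothesis F_incr : {homo F : x y / x < y}.

(** Makes the logarithms of [F] meaningful. A value [F z <= 0] would make [F (z - 1)] negative, and
    [F] still smaller further left, against the limit 0 at -oo. *)
Lemma increasing_cumulative_gt0 z : 0 < F z.
Proof.
rewrite ltNge; apply/negP => Fz.
have Fz1 : F (z - 1) < 0 by apply: lt_le_trans Fz; apply: F_incr; lra.
have [y [/= + yz]] := filter_ex (filterI (cvgr_gt _ (cumulativeNy F) _ Fz1)
  (nbhs_ninfty_lt (num_real (z - 1)))).
by rewrite ltNge (ltW (F_incr yz)).
Qed.

Lemma increasing_cumulative_inj : injective F.
Proof.
move=> x y Fxy; by case: (ltgtP x y) => // /F_incr; rewrite Fxy ltxx.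
Qed.

Variables delta c : R.

(* [ln (F (a + b * y))] is [tail_slope b * y + tail_intercept a b + o(1)] as
   [y] tends to +oo; its expansion at -oo is that of [b := - b] in [- y]. *)
Definition tail_slope (b : R) : R := if b < 0 then delta * b else 0.

Definition tail_intercept (a b : R) : R :=
  if b < 0 then delta * a + ln c else if b == 0 then ln (F a) else 0.

(** For [b < 0] the argument of [F] tends to -oo, where [F z] is equivalent to
    [c * expR (delta * z)]; for [b > 0] it tends to +oo, where [F] tends to 1; for [b = 0] the
    remainder is identically 0. *)
Lemma ln_response_tail a b : exp_left_tail F delta c ->
  ln (F (a + b * y)) - (tail_slope b * y + tail_intercept a b)
    @[y --> +oo] --> (0 : R).
Proof.
move=> [d0 c0 Fc]; rewrite /tail_slope /tail_intercept.
case: ltgtP => [b0|b0|->].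
- rewrite [X in _ --> X](_ : 0 = ln c - ln c); last by ring.
  rewrite (_ : (fun y => _) = fun y =>
    ln (F (a + b * y) / expR (delta * (a + b * y))) - ln c).
    apply: cvgB; last exact: cvg_cst.
    exact: (cvg_comp _ _ (cvgNy_affine a b0) (cvg_lnF c0 Fc)).
  apply/funext => y.
  rewrite ln_div ?posrE ?expR_gt0 ?increasing_cumulative_gt0// expRK; ring.
- rewrite (_ : (fun y => _) = fun y => ln (F (a + b * y))).
    rewrite -[X in _ --> X]ln1.
    exact: (cvg_comp _ _ (cvgy_affine a b0) (cvg_lnF ltr01 (cumulativey F))).
  by apply/funext => y; ring.
- rewrite (_ : (fun y => _) = fun=> 0); first exact: cvg_cst.
  by apply/funext => y; rewrite mul0r addr0; ring.
Qed.

Variable p : nat.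
Implicit Types (t : param R p) (x : 'cV[R]_p).

Lemma ln_outcome_pdf t x y : 0 < sigma2 t ->
  0 < outcome_pdf t x y /\
  ln (outcome_pdf t x y) = ln (normal_peak 1) - ln (Num.sqrt (sigma2 t))
    - (y - affine (gamma0 t) (gamma1 t) x) ^+ 2 / (2 * sigma2 t).
Proof.
move=> s0; have r0 : 0 < Num.sqrt (sigma2 t) by rewrite sqrtr_gt0.
have pk : 0 < normal_peak (1 : R) by rewrite normal_peak_gt0 ?oner_neq0.
rewrite /outcome_pdf normal_pdfE ?oner_neq0// /normal_fun subr0.
set e := expR _.
have e0 : 0 < e by exact: expR_gt0.
split; first by rewrite mulr_gt0 ?invr_gt0// mulr_gt0.
rewrite lnM ?posrE ?invr_gt0 ?(mulr_gt0 pk)// lnM ?posrE// lnV ?posrE// expRK.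
rewrite mulNr expr_div_n sqr_sqrtr ?ltW//.
by field; rewrite gt_eqF.
Qed.

Hypothesis F_tail : exp_left_tail F delta c.

Lemma observed_eq_tail t t' x : 0 < sigma2 t -> 0 < sigma2 t' ->
  (forall y, observed F t' x y = observed F t x y) ->
  let mu u := affine (gamma0 u) (gamma1 u) x in
  let a u := affine (alpha0 u) (alpha1 u) x in
  sigma2 t' = sigma2 t /\
  [\/ [/\ beta t' = beta t, mu t' = mu t & a t' = a t] |
    [/\ beta t' = - beta t, beta t != 0 &
      2 * delta * (a t + beta t * mu t) + delta ^+ 2 * sigma2 t * beta t ^+ 2
        + 2 * ln c = 0]].
Proof.
move=> s0 s'0 obs mu a.
have [d0 _ _] := F_tail.
pose K (u : param R p) := ln (normal_peak 1) - ln (Num.sqrt (sigma2 u)).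
have eqln y : K t - (y - mu t) ^+ 2 / (2 * sigma2 t) + ln (F (a t + beta t * y))
   = K t' - (y - mu t') ^+ 2 / (2 * sigma2 t') + ln (F (a t' + beta t' * y)).
  have [pt lt] := ln_outcome_pdf x y s0; have [pt' lt'] := ln_outcome_pdf x y s'0.
  have := congr1 (@ln R) (obs y); rewrite /observed /response_prob.
  rewrite lnM ?posrE ?increasing_cumulative_gt0// lt'.
  by rewrite lnM ?posrE ?increasing_cumulative_gt0// lt.
have [ss' mP nP] := gaussian_tail_eq s0 s'0
  (ln_response_tail (a t) (beta t) F_tail)
  (ln_response_tail (a t') (beta t') F_tail) eqln.
(* The end -oo is reached by substituting [- y] for [y], which negates [mu] and [beta] and keeps
   [K], [a] and the variances. *)
have [] := @gaussian_tail_eq _ (K t) (K t') _ _ (- mu t) (- mu t') _ _ _ _ _ _ s0 s'0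
  (ln_response_tail (a t) (- beta t) F_tail)
  (ln_response_tail (a t') (- beta t') F_tail).
  move=> y; have := eqln (- y); rewrite !mulrN !mulNr.
  by rewrite -!opprD !sqrrN !opprK.
move=> _ mN nN; split=> //.
have KK : K t' = K t by rewrite /K ss'.
move: mP nP mN nN; rewrite KK subrr add0r !sqrrN /tail_slope /tail_intercept.
rewrite !oppr_lt0 !oppr_eq0.
set s := sigma2 t in s0 *; set u := mu t; set u' := mu t'.
set A := a t; set A' := a t'; set b := beta t; set b' := beta t'.
(* [X] is made opaque and [u'] is expressed through it: division by [s] disappears, and the sign
   cases below reduce to linear arithmetic. *)
have [X XE] : exists X, X = (u' - u) / s by exists ((u' - u) / s).
have -> : (- u' - - u) / s = - X by rewrite XE; ring.
have u'E : u' = u + s * X by rewrite XE; field; rewrite gt_eqF.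
have -> : (u ^+ 2 - u' ^+ 2) / (2 * s) = - (X * (2 * u + s * X) / 2).
  by rewrite u'E; field; rewrite gt_eqF.
rewrite -XE; clear XE.
set Q := [\/ _ | _].
have same_sign : b' = b -> X = 0 -> A' = A -> Q.
  by move=> bE X0 AE; left; split=> //; rewrite u'E X0; ring.
(* Inserting [X = delta * b] into the intercept equation yields the relation of the second
   alternative. *)
have opp_sign : b != 0 -> delta * (b + b') = 0 -> X = delta * b ->
  delta * A + ln c = - (X * (2 * u + s * X) / 2) -> Q.
  move=> b0 /eqP; rewrite mulf_eq0 gt_eqF//= addr_eq0 => /eqP bE XE nE; right.
  split=> //; first by rewrite bE opprK.
  have -> : 2 * delta * (A + b * u) = 2 * (delta * A + ln c) - 2 * ln c
     + 2 * delta * b * u by ring.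
  by rewrite nE XE; field.
have d0' : delta != 0 by rewrite gt_eqF.
have dI := mulfI d0'.
(* Equal nonzero signs: at one end both slopes are 0, so [X = 0]. Opposite signs: the two ends give
   [X = delta * b] and [X = - delta * b']. Exactly one of them zero: one end gives [X = 0], and the
   other then contradicts the nonzero sign. Both zero: the response is constant in [y], and
   injectivity of [F] recovers [A]. *)
case: (ltgtP b 0) => b0; case: (ltgtP b' 0) => b'0 mP nP mN nN.
- have X0 : X = 0 by lra.
  rewrite X0 in mP nP; apply: same_sign => //; apply: dI; lra.
- apply: opp_sign; rewrite ?lt_eqF//; lra.
- have : b = 0; [apply: dI; lra|lra].
- apply: opp_sign; rewrite ?gt_eqF//; lra.
- have X0 : X = 0 by lra.
  rewrite X0 in mN nN; apply: same_sign => //; apply: dI; lra.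
- have : b = 0; [apply: dI; lra|lra].
- have : b' = 0; [apply: dI; lra|lra].
- have : b' = 0; [apply: dI; lra|lra].
- have X0 : X = 0 by lra.
  apply: same_sign => //; first by rewrite b0 b'0.
  apply: increasing_cumulative_inj; apply: ln_inj;
    rewrite ?posrE ?increasing_cumulative_gt0//.
  rewrite X0 in nP; lra.
Qed.

End tails.

(** * From relations at each covariate value to the coefficients, and the logistic converse *)

Lemma affine0 (R : realType) p (x : 'cV[R]_p) : affine 0 0 x = 0.
Proof. by rewrite /affine mulmx0 mxE addr0. Qed.

Lemma affineD (R : realType) p (a a' : R) (b b' x : 'cV[R]_p) :
  affine (a + a') (b + b') x = affine a b x + affine a' b' x.
Proof. by rewrite /affine mulmxDr mxE; ring. Qed.

Lemma affineZ (R : realType) p (k a : R) (b x : 'cV[R]_p) :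
  affine (k * a) (k *: b) x = k * affine a b x.
Proof. by rewrite /affine -scalemxAr mxE; ring. Qed.

(** Presents the relation for [beta t' = - beta t] in [observed_eq_tail] as the vanishing of an
    affine function of [x], so that [one_to_one_coefficients] applies to it. *)
Lemma affine_tau (R : realType) p (delta c : R) (t : param R p) x :
  affine (tau1 delta c t) ((2 * delta) *: tau2 t) x =
  2 * delta * (affine (alpha0 t) (alpha1 t) x
    + beta t * affine (gamma0 t) (gamma1 t) x)
  + delta ^+ 2 * sigma2 t * beta t ^+ 2 + 2 * ln c.
Proof.
rewrite -affineZ -affineD -affineZ /tau1 /tau2 /affine; ring.
Qed.

Lemma one_to_one_nonempty (R : realType) p (X : set 'cV[R]_p) :
  one_to_one_coefficients X -> X !=set0.
Proof.
move=> X_coef; apply/set0P/eqP => X0.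
have [|/eqP] := X_coef 0 1 0 0; first by rewrite X0.
by rewrite eq_sym oner_eq0.
Qed.

(** Since [beta] does not depend on [x], the same alternative of [observed_eq_tail] holds on all of
    [X]. The first one identifies all coefficients; the second makes [tau1] and [tau2] vanish. *)
Lemma tau_neq0_identifiable (R : realType) p (X : set 'cV[R]_p)
    (F : cumulativeBounded (0 : R) (1 : R)) (delta c : R) (t : param R p) :
  one_to_one_coefficients X -> {homo F : x y / x < y} ->
  exp_left_tail F delta c -> 0 < sigma2 t ->
  tau1 delta c t != 0 \/ tau2 t != 0 -> identifiable F X t.
Proof.
move=> X_coef F_incr F_tail s0 tau t' s'0 obs.
have cases x (Xx : X x) := observed_eq_tail F_incr F_tail s0 s'0 (obs x Xx).
have [x0 Xx0] := one_to_one_nonempty X_coef; have [ss' _] := cases x0 Xx0.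
have [bb'|bb'] := eqVneq (beta t') (beta t).
  have eqs x : X x ->
      affine (gamma0 t') (gamma1 t') x = affine (gamma0 t) (gamma1 t) x /\
      affine (alpha0 t') (alpha1 t') x = affine (alpha0 t) (alpha1 t) x.
    move=> /cases[_ [[]//|[]]]; rewrite bb' => b0 /eqP bn0; exfalso; apply: bn0.
    lra.
  have [g0 g1] := X_coef _ _ _ _ (fun x Xx => (eqs x Xx).1).
  have [a0 a1] := X_coef _ _ _ _ (fun x Xx => (eqs x Xx).2).
  by case: t t' {tau cases eqs obs s0 s'0} ss' bb' g0 g1 a0 a1
    => ? ? ? ? ? ? [? ? ? ? ? ?] /= -> -> -> -> -> ->.
have [x Xx|t1 t2] := X_coef (tau1 delta c t) 0 ((2 * delta) *: tau2 t) 0.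
  rewrite affine_tau affine0.
  by have [_ [[/eqP]|[]//]] := cases x Xx; rewrite (negbTE bb').
have [d0 _ _] := F_tail.
case: tau => /eqP []//; apply/eqP; move/eqP: t2.
by rewrite scaler_eq0 gt_eqF// mulr_gt0.
Qed.

(* The outcome density is tilted by [exp (a + beta y)], which turns
   [logistic (a + beta y)] into [logistic (- (a + beta y))]. *)
Lemma logistic_tau0_not_identifiable (R : realType) p (X : set 'cV[R]_p)
    (t : param R p) : 0 < sigma2 t -> beta t != 0 ->
  tau1 1 1 t = 0 -> tau2 t = 0 -> ~ identifiable (@logistic R) X t.
Proof.
move=> s0 b0 t1 t2.
pose t' := Param (gamma0 t + beta t * sigma2 t) (gamma1 t) (sigma2 t)
  (- alpha0 t) (- alpha1 t) (- beta t).
move=> idt; suff /(congr1 (@beta R p))/= bE : t' = t.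
  by move/eqP: b0; apply; lra.
apply: (idt t' s0) => x _ y.
have := affine_tau 1 1 t x; rewrite t1 t2 scaler0 affine0 ln1.
rewrite /observed /response_prob /outcome_pdf /=.
rewrite (_ : affine (gamma0 t + _) _ x =
  affine (gamma0 t) (gamma1 t) x + beta t * sigma2 t); last first.
  by rewrite /affine; ring.
rewrite (_ : affine (- _) _ x = - affine (alpha0 t) (alpha1 t) x); last first.
  by rewrite /affine mulmxN mxE opprD.
set mu := affine (gamma0 _) _ x; set a := affine (alpha0 _) _ x => tau.
rewrite -!mulrA; congr (_ * _).
rewrite mulNr -opprD logistic_expRN opprK.
rewrite normal_pdfE ?oner_neq0// /normal_fun !subr0 /logistic.
rewrite -!mulrA; congr (_ * _); rewrite !mulrA -expRD; congr (expR _ / _).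
rewrite !expr_div_n sqr_sqrtr ?ltW//.
(* This is [tau] solved for [a]: it normalises the tilt, so that completing the square gives exactly
   the normal density with mean shifted by [beta t * sigma2 t]. *)
have -> : a = - (sigma2 t * beta t ^+ 2) / 2 - beta t * mu by lra.
by field; rewrite gt_eqF.
Qed.

Theorem corollary2 (R : realType) (p : nat) (X : set 'cV[R]_p)
    (X_coef : one_to_one_coefficients X) :
  (forall (F : cumulativeBounded (0 : R) (1 : R)) (delta c : R),
     {homo F : x y / x < y} ->
     exp_left_tail F delta c ->
     forall t : param R p, 0 < sigma2 t ->
       tau1 delta c t != 0 \/ tau2 t != 0 -> identifiable F X t)
  /\
  (forall t : param R p, 0 < sigma2 t ->
     (tau1 1 1 t != 0 \/ tau2 t != 0 -> identifiable (@logistic R) X t) /\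
     (beta t != 0 ->
      identifiable (@logistic R) X t -> tau1 1 1 t != 0 \/ tau2 t != 0)).
Proof.
split=> [F delta c F_incr F_tail t s0|t s0]; first exact: tau_neq0_identifiable.
split.
  apply: (tau_neq0_identifiable X_coef _ _ s0).
  - exact: logistic_increasing.
  - exact: logistic_exp_left_tail.
move=> b0 idt; apply: contrapT => /not_orP[/negP/negPn/eqP t1 /negP/negPn/eqP t2].
exact: logistic_tau0_not_identifiable s0 b0 t1 t2 idt.
Qed.
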